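(* There is an absolute constant $C_1>0$ such that the following holds. Let $k=k(n)$ and $d=d(n)$ be positive integers with $k\,d\log_2 d=o(n)$. Then for all sufficiently large $n$, as classes of Boolean functions $f:\{0,1\}^n\to\{0,1\}$, $$k\text{-id-}\mathbf{QOBDD}_{\sqrt{d/(C_1k)}}\subsetneq k\text{-id-}\mathbf{QOBDD}_{d^2}.$$
   Context: A quantum $k$-OBDD ($k$-QOBDD) of width $w$ on $n$ input bits with order $\pi$ (a permutation of $\{1,\dots,n\}$) is given by an initial state $|q_0\rangle$ (a standard basis vector of $\mathbb{C}^w$), a set $Accept\subseteq\{1,\dots,w\}$, and for each step $s=1,\dots,kn$ a pair of unitary $w\times w$ matrices $(G_s^0,G_s^1)$. On input $\sigma\in\{0,1\}^n$, starting from $|\psi_0\rangle=|q_0\rangle$, at step $s$ the bit $\sigma_{\pi(j)}$ with $j=((s-1)\bmod n)+1$ is read and $|\psi_s\rangle=G_s^{\sigma_{\pi(j)}}|\psi_{s-1}\rangle$ (so the input is read $k$ times in order $\pi$). At the end the state $|\psi_{kn}\rangle=(v_1,\dots,v_w)$ is measured and $\sigma$ is accepted with probability $\sum_{i\in Accept}|v_i|^2$. It computes $f$ with bounded error if there is $\varepsilon>0$ such that inputs with $f(\sigma)=1$ are accepted with probability at least $1/2+\varepsilon$ and inputs with $f(\sigma)=0$ with probability at most $1/2-\varepsilon$. $k\text{-id-}\mathbf{QOBDD}_W$ is the set of Boolean functions $f:\{0,1\}^n\to\{0,1\}$ computed with bounded error by a $k$-QOBDD of width at most $W$ with the natural order $\pi=(1,\dots,n)$.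 *)

(* Defs.v *)
From mathcomp Require Import all_boot all_order all_algebra all_fingroup.
From mathcomp Require Import all_classical all_reals all_analysis.
From mathcomp Require Import complex.

Set Implicit Arguments.
Unset Strict Implicit.
Unset Printing Implicit Defensive.

Import Order.TTheory GRing.Theory Num.Theory.
Import numFieldNormedType.Exports.
Local Open Scope classical_set_scope.
Local Open Scope ring_scope.

Definition boolfun (n : nat) := {ffun 'I_n -> bool} -> bool.

Lemma read_pos_subproof (k n : nat) (s : 'I_(k * n)) : (s %% n < n)%N.
Proof. by case: n s => [|n] s; [case: s => m; rewrite muln0 | exact: ltn_pmod]. Qed.

(* Steps and positions are numbered from 0, so the position read at step s
   is s mod n rather than ((s - 1) mod n) + 1. *)
Definition read_pos (k n : nat) (s : 'I_(k * n)) : 'I_n :=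
  Ordinal (read_pos_subproof s).

(* The initial state is the basis vector indexed by qinit; in particular
   the width w is necessarily positive. *)
Record kQOBDD (R : realType) (k n w : nat) := KQOBDD {
  qorder : 'S_n;
  qinit : 'I_w;
  qaccept : {set 'I_w};
  qgate : 'I_(k * n) -> bool -> 'M[R[i]]_w;
  qgate_unitary : forall s b, qgate s b \is unitarymx
}.

Section Semantics.
Variables (R : realType) (k n w : nat) (P : kQOBDD R k n w).

Definition qstep (sigma : {ffun 'I_n -> bool}) (psi : 'cV[R[i]]_w)
    (s : 'I_(k * n)) : 'cV[R[i]]_w :=
  qgate P s (sigma (qorder P (read_pos s))) *m psi.

(* enum 'I_(k * n) lists the steps in increasing order. *)
Definition qfinal (sigma : {ffun 'I_n -> bool}) : 'cV[R[i]]_w :=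
  foldl (qstep sigma) (delta_mx (qinit P) 0) (enum 'I_(k * n)).

Definition accept_prob (sigma : {ffun 'I_n -> bool}) : R :=
  \sum_(i in qaccept P) ComplexField.Normc.normc (qfinal sigma i 0) ^+ 2.

Definition computes_bounded_error (f : boolfun n) : Prop :=
  exists2 eps : R, 0 < eps &
    forall sigma,
      (f sigma = true -> 1 / 2 + eps <= accept_prob sigma) /\
      (f sigma = false -> accept_prob sigma <= 1 / 2 - eps).

End Semantics.

(* The width bound W is real, since it is instantiated with a square root;
   the natural order is the identity permutation. *)
Definition id_QOBDD (R : realType) (k n : nat) (W : R) : set (boolfun n) :=
  [set f | exists (w : nat) (P : kQOBDD R k n w),
    [/\ w%:R <= W, qorder P = 1%g & computes_bounded_error P f]].

Definition log2 (R : realType) (x : R) : R := ln x / ln 2.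

(* Main.v *)
(** For a fixed number of inputs the gap eps may be arbitrarily small, so a
    program only determines the sign of [accept_prob - 1/2], and counting
    arguments based on nets of states are not available. Instead, cut the input
    at a position c: the bits read after the cut act only through k complex
    w x w matrices, and for each of M fixed prefixes the acceptance probability
    is a polynomial of degree 2k in the 2kw^2 real coordinates of these
    matrices. A Warren-type bound on the number of sign patterns of polynomials
    shows that at most (4kM + 1)^(2kw^2) suffixes can be distinguished by the M
    prefixes. The bound itself comes from choosing a critical point of a
    suitable perturbation in each sign cell: these points solve equations
    [x_j ^ (E + 1) = g_j(x)] with [deg g_j <= E], and such a system has at most
    (E + 1)^n solutions, since modulo it every polynomial reduces to monomials
    with exponents at most E.

    The separating function reads an address in [0, m) and then m data bits, and
    returns the addressed bit; it is computed by a single pass of a reversible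
    program of width 2m, while its 2^m suffixes are pairwise distinguished by m
    prefixes. For d >= 16 k take m = d * floor(log2 d): then 2m <= d^2, 2m <= n
    for large n, and 16 k w^2 <= d contradicts the counting bound. For d < 16 k
    the smaller class is empty. *)

From HB Require Import structures.
Require Import Defs.
From mathcomp Require Import all_boot all_order all_algebra all_fingroup.
From mathcomp Require Import all_classical all_reals all_analysis.
From mathcomp Require Import complex zify lra.
From mathcomp Require Import -(notations) mpoly.

Set Implicit Arguments.
Unset Strict Implicit.
Unset Printing Implicit Defensive.

Import Order.TTheory GRing.Theory Num.Theory.
Import numFieldNormedType.Exports.
Local Open Scope classical_set_scope.
Local Open Scope ring_scope.

(* The notations of mpoly cannot be imported next to those of the analysis
   library: they assign opposite associativities to level 2. *)
Local Notation "{ 'mpoly' R [ n ] }" := (mpoly n R)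
  (n at level 2, format "{ 'mpoly'  R [ n ] }") : type_scope.
Local Notation "p .@[ v ]" := (meval v p)
  (at level 1, left associativity, format "p .@[ v ]") : ring_scope.
Local Notation msize p := (mmeasure mdeg p).
Local Notation "''X_[' R , m ]" := (mpolyX R m)
  (at level 8, format "''X_[' R ,  m ]") : ring_scope.
Local Notation normc := ComplexField.Normc.normc.

Section DegreeBounds.
Variables (R : comNzRingType) (n : nat).
Implicit Types (p q : {mpoly R[n]}) (D : nat).

Definition deg_le D p : bool := (msize p <= D.+1)%N.

Lemma deg_leP D p :
  reflect (forall m, m \in msupp p -> (mdeg m <= D)%N) (deg_le D p).
Proof.
rewrite /deg_le msizeE.
by apply: (iffP (bigmax_leqP_seq _ _ _ _)) => pD m => [mp|mp _]; exact: pD.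
Qed.

Lemma deg_leW D1 D2 p : (D1 <= D2)%N -> deg_le D1 p -> deg_le D2 p.
Proof. by move=> leD /leq_trans; exact. Qed.

Lemma deg_leC D c : deg_le D (mpolyC n c).
Proof. by rewrite /deg_le mmeasureC; case: eqP. Qed.

Lemma deg_leX m : deg_le (mdeg m) 'X_[R, m].
Proof. by rewrite /deg_le msizeX. Qed.

Lemma deg_leXU j : deg_le 1 'X_[R, mnm1 j].
Proof. by rewrite -(mdeg1 j) deg_leX. Qed.

Lemma deg_leD D p q : deg_le D p -> deg_le D q -> deg_le D (p + q).
Proof.
move=> pD qD; apply: leq_trans (mmeasureD_le _ _ _) _.
by rewrite geq_max; apply/andP.
Qed.

Lemma deg_leZ D c p : deg_le D p -> deg_le D (c *: p).
Proof. exact: leq_trans (msizeZ_le _ _). Qed.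

Lemma deg_leB D p q : deg_le D p -> deg_le D q -> deg_le D (p - q).
Proof. by move=> pD qD; rewrite -scaleN1r deg_leD // deg_leZ. Qed.

Lemma deg_le_sum D (I : Type) (r : seq I) (P : pred I)
    (F : I -> {mpoly R[n]}) :
  (forall i, P i -> deg_le D (F i)) -> deg_le D (\sum_(i <- r | P i) F i).
Proof.
move=> FD; elim/big_ind: _ => //; last exact: deg_leD.
by rewrite /deg_le mmeasure0.
Qed.

Lemma deg_leM D1 D2 p q :
  deg_le D1 p -> deg_le D2 q -> deg_le (D1 + D2) (p * q).
Proof.
move=> /deg_leP pD /deg_leP qD; apply/deg_leP => m.
move=> /msuppM_le /allpairsP[[m1 m2]] [] /= /pD m1D /qD m2D ->.
by rewrite mdegD leq_add.
Qed.

Lemma deg_le_prod D (I : finType) (F : I -> {mpoly R[n]}) :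
  (forall i, deg_le D (F i)) -> deg_le (#|I| * D) (\prod_i F i).
Proof.
move=> FD; rewrite -sum_nat_const.
by elim/big_ind2: _ => // [|p1 D1 p2 D2]; [exact: deg_leC|exact: deg_leM].
Qed.

Lemma deg_leXn D k p : deg_le D p -> deg_le (k * D) (p ^+ k).
Proof.
move=> pD; have := deg_le_prod (fun _ : 'I_k => pD).
by rewrite prodr_const card_ord.
Qed.

Lemma deg_le_mderiv D i p : deg_le D p -> deg_le D (mderiv i p).
Proof.
move=> /deg_leP pD; rewrite /mderiv big_seq; apply: deg_le_sum => m /pD mD.
apply/deg_leZ/deg_leW/deg_leX; exact: leq_trans (mdegB _ _) mD.
Qed.

End DegreeBounds.

Section FiniteSolutionSets.
Variables (F : fieldType) (n : nat) (T : finType) (z : T -> 'rV[F]_n).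
Implicit Types (p : {mpoly F[n]}).

Lemma mpoly_interpolation t : injective z ->
  exists p, forall t', p.@[z t' 0] = (t' == t)%:R.
Proof.
move=> z_inj.
have /choice[l lP] t' : exists p : {mpoly F[n]},
    t' != t -> p.@[z t 0] = 1 /\ p.@[z t' 0] = 0.
  have [/forallP zE|/forallPn[j zj]] := boolP [forall j, z t' 0 j == z t 0 j].
    have /z_inj -> : z t' = z t by apply/rowP => j; exact/eqP.
    by exists 0; rewrite eqxx.
  exists ((z t 0 j - z t' 0 j)^-1 *:
          ('X_[F, mnm1 j] - mpolyC n (z t' 0 j))) => _.
  rewrite !mevalZ !mevalB !mevalXU !mevalC subrr mulr0 mulVf //.
  by rewrite subr_eq0 eq_sym.
exists (\prod_(s | s != t) l s) => t'; rewrite rmorph_prod /=.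
have [->|t't] := eqVneq t' t; first by rewrite big1 // => s /lP[].
by rewrite (bigD1 t') //= (lP _ t't).2 mul0r.
Qed.

Definition values p : 'rV[F]_#|T| := \row_t p.@[z (enum_val t) 0].

Fact values_is_linear : linear values.
Proof. by move=> c p q; apply/rowP => t; rewrite !mxE mevalD mevalZ. Qed.

HB.instance Definition _ :=
  GRing.isLinear.Build F {mpoly F[n]} 'rV[F]_#|T| _ values values_is_linear.

Definition low_monomial E (e : {ffun 'I_n -> 'I_E.+1}) : multinom n :=
  Multinom [tuple e i : nat | i < n].

Definition low_values_mx E : 'M[F]_(#|{ffun 'I_n -> 'I_E.+1}|, #|T|) :=
  \matrix_e values 'X_[F, low_monomial (enum_val e)].

(* On the points of z the equations rewrite a monomial in which some exponent
   exceeds E into a polynomial of smaller degree. *)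
Lemma values_monomial_sub E (g : 'I_n -> {mpoly F[n]}) m :
  (forall j, deg_le E (g j)) ->
  (forall t j, z t 0 j ^+ E.+1 = (g j).@[z t 0]) ->
  (values 'X_[F, m] <= low_values_mx E)%MS.
Proof.
move=> gE zE; have [N] := ubnP (mdeg m); elim: N m => // N IHN m mN.
have [/forallP m_low|/forallPn[j]] := boolP [forall i, (m i < E.+1)%N].
  pose e : {ffun 'I_n -> 'I_E.+1} := [ffun i => Ordinal (m_low i)].
  have -> : m = low_monomial (enum_val (enum_rank e)).
    by apply/mnmP => i; rewrite enum_rankK mnmE ffunE.
  rewrite -(rowK (fun e => values 'X_[F, low_monomial (enum_val e)])).
  exact: row_sub.
rewrite -leqNgt => Emj; pose m' := mnm_sub m (mnm_muln (mnm1 j) E.+1).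
have mE : mnm_add m' (mnm_muln (mnm1 j) E.+1) = m.
  apply: submK; apply/mnm_lepP => i; rewrite mulmnE mnm1E.
  by have [<-|] := eqVneq j i; rewrite ?mul1n.
have -> : values 'X_[F, m] = values ('X_[F, m'] * g j).
  apply/rowP => t; rewrite !mxE mevalM -zE -[in LHS]mE mpolyXD mevalM.
  by rewrite -mpolyXn rmorphXn /= mevalXU.
rewrite [_ * g j]mpolyE linear_sum big_seq; apply: summx_sub => m'' m''P.
rewrite linearZ scalemx_sub // IHN //.
have := deg_leP _ _ (deg_leM (deg_leX F m') (gE j)) _ m''P.
move=> /leq_ltn_trans; apply; apply: leq_trans _ (mN : _ <= N)%N.
by rewrite -mE mdegD mdegMn mdeg1 mul1n addnS.
Qed.

Lemma card_solutions E (g : 'I_n -> {mpoly F[n]}) :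
  injective z -> (forall j, deg_le E (g j)) ->
  (forall t j, z t 0 j ^+ E.+1 = (g j).@[z t 0]) ->
  (#|T| <= E.+1 ^ n)%N.
Proof.
move=> z_inj gE zE.
have : (1%:M <= low_values_mx E)%MS.
  apply/row_subP => t; have [p pE] := mpoly_interpolation (enum_val t) z_inj.
  have -> : row t 1%:M = values p.
    by apply/rowP => t'; rewrite !mxE pE (inj_eq enum_val_inj) eq_sym.
  rewrite [p]mpolyE linear_sum; apply: summx_sub => m _.
  by rewrite linearZ scalemx_sub // (values_monomial_sub _ gE).
move/mxrankS; rewrite mxrank1 => /leq_trans -> //.
by rewrite (leq_trans (rank_leq_row _)) // card_ffun !card_ord.
Qed.

End FiniteSolutionSets.

Lemma exists_small_scale (R : realFieldType) (T : finType) (a b : T -> R) :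
  (forall t, 0 <= a t) -> (forall t, 0 < b t) ->
  exists2 eta : R, 0 < eta & forall t, eta * a t < b t.
Proof.
move=> a_ge0 b_gt0; have a1_gt0 t : 0 < a t + 1 by rewrite ltr_wpDl.
exists (\big[Num.min/1]_t (b t / (a t + 1))).
  by apply: lt_bigmin => // t _; rewrite divr_gt0.
move=> t; apply: (@le_lt_trans _ _ (b t / (a t + 1) * a t)).
  by rewrite ler_wpM2r //; exact: bigmin_le_cond.
by rewrite mulrAC ltr_pdivrMr // ltr_pM2l // ltrDl.
Qed.

Section PolynomialAnalysis.
Variables (R : realType) (n : nat).
Implicit Types (p : {mpoly R[n]}) (x : 'rV[R]_n) (E : nat).

Lemma meval_continuous p : continuous (fun x => p.@[x 0]).
Proof.
under eq_fun do rewrite mevalE.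
apply: continuous_big => [|m _ x]; first exact: add_continuous.
apply: continuousM; first exact: cst_continuous.
move: x; apply: continuous_big => [|j _ x]; first exact: mul_continuous.
apply: (@continuous_comp _ _ _ (fun y : 'rV[R]_n => y 0 j) (fun u => u ^+ m j)).
  exact: coord_continuous.
exact: exprn_continuous.
Qed.

Lemma ler_normr_coord x j : `|x 0 j| <= `|x|.
Proof.
rewrite {2}/Num.norm /= mx_normrE.
exact: (le_bigmax _ (fun ij => `|x ij.1 ij.2|) (0, j)).
Qed.

Lemma normr_coord_attained x : x != 0 -> exists j, `|x 0 j| = `|x|.
Proof.
rewrite -normr_eq0 => /mx_norm_neq0[[i j] xE].
by exists j; rewrite -[in LHS](ord1 i) -xE.
Qed.

Lemma meval_growth D p : deg_le D p ->
  exists2 C, 0 <= C & forall x, 1 <= `|x| -> `|p.@[x 0]| <= C * `|x| ^+ D.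
Proof.
move=> /deg_leP pD; exists (\sum_(m <- msupp p) `|mcoeff m p|) => [|x x_ge1].
  exact: sumr_ge0.
rewrite mevalE mulr_suml big_seq [leRHS]big_seq.
apply: le_trans (ler_norm_sum _ _ _) _.
apply: ler_sum => m /pD mD; rewrite normrM ler_wpM2l // normr_prod.
apply: (@le_trans _ _ (`|x| ^+ mdeg m)); last exact: ler_weXn2l.
rewrite mdegE -prodrXr; apply: ler_prod => j _.
by rewrite normr_ge0 normrX lerXn2r ?nnegrE ?ler_normr_coord.
Qed.

Lemma mevalX_line m x j (t : R) :
  'X_[R, m].@[(x + t *: delta_mx 0 j) 0] =
  (\prod_(i | i != j) x 0 i ^+ m i) * (x 0 j + t) ^+ m j.
Proof.
rewrite mevalX (bigD1 j) //= mulrC !mxE !eqxx mulr1; congr (_ * _).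
by apply: eq_bigr => i /negPf ij; rewrite !mxE ij andbF mulr0 addr0.
Qed.

Lemma is_derive_meval p x j (t : R) :
  is_derive t 1 (fun t => p.@[(x + t *: delta_mx 0 j) 0])
    (mderiv j p).@[(x + t *: delta_mx 0 j) 0].
Proof.
elim/mpolyind: p => [|c m p _ _ IHp].
  under eq_fun do rewrite meval0.
  by rewrite mderiv0 meval0; exact: is_derive_cst.
under eq_fun do rewrite mevalD mevalZ mevalX_line mulrA.
rewrite mderivD mderivZ mevalD mevalZ mderivX mevalZ mevalX_line.
rewrite mnmBE mnm1E eqxx subn1; apply: is_deriveD.
have dX : is_derive t 1 (fun u => (x 0 j + u) ^+ m j)
    ((m j)%:R * (x 0 j + t) ^+ (m j).-1).
  have -> : (fun u => (x 0 j + u) ^+ m j) = (cst (x 0 j) + id) ^+ m j.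
    by apply/funext => u; rewrite exprfctE.
  have := is_deriveX (m j)
    (is_deriveD (is_derive_cst (x 0 j) t 1) (is_derive_id t 1)).
  by rewrite add0r [_ *: 1]mulr1.
set K := \prod_(i | _) x 0 i ^+ m i.
have -> : \prod_(i < n | i != j) x 0 i ^+ mnm_sub m (mnm1 j) i = K.
  by apply: eq_bigr => i /negPf ij; rewrite mnmBE mnm1E eq_sym ij subn0.
by rewrite (mulrCA _ K) [c * (_ * _)]mulrA; have := is_deriveZ (c * K) dX.
Qed.

Lemma mderiv_local_min p x j :
  (\forall y \near x, p.@[x 0] <= p.@[(y : 'rV[R]_n) 0]) ->
  (mderiv j p).@[x 0] = 0.
Proof.
move=> x_min; pose line (t : R) : 'rV[R]_n := x + t *: delta_mx 0 j.
have line0 : line 0 = x by rewrite /line scale0r addr0.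
have line_cvg : line t @[t --> (0 : R)] --> x.
  rewrite -[X in _ --> X]line0.
  by apply: cvgD; [exact: cvg_cst|exact: scalel_continuous].
have /nbhs_ballP[e /= e_gt0 eP] := line_cvg _ x_min.
have [_ d0] : is_derive (0 : R) 1 (fun t => p.@[line t 0]) 0.
  apply: (@derive1_at_min _ _ (- e) e).
  - by rewrite ge0_cp // ltW.
  - by move=> t _; have [] := is_derive_meval p x j t.
  - by rewrite in_itv /= oppr_lt0 e_gt0.
  - move=> t; rewrite in_itv /= -ltr_norml line0 => te.
    by apply: eP; rewrite /ball /= sub0r normrN.
by have [_] := is_derive_meval p x j 0; rewrite d0 -/(line 0) line0 => <-.
Qed.

Definition power_sum k : {mpoly R[n]} := \sum_j 'X_[R, mnm1 j] ^+ k.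

Lemma meval_power_sum k x : (power_sum k).@[x 0] = \sum_j x 0 j ^+ k.
Proof.
by rewrite raddf_sum; apply: eq_bigr => j _; rewrite /= rmorphXn /= mevalXU.
Qed.

Lemma power_sum_ge0 k x : ~~ odd k -> 0 <= (power_sum k).@[x 0].
Proof.
move=> k_even; rewrite meval_power_sum sumr_ge0 // => j _.
exact: exprn_even_ge0.
Qed.

Lemma mderiv_power_sum k j :
  mderiv j (power_sum k) = k%:R *: 'X_[R, mnm1 j] ^+ k.-1.
Proof.
rewrite raddf_sum (bigD1 j) //= big1 => [|i /negPf ij].
  rewrite addr0 !mpolyXn mderivX mulmnE mnm1E eqxx mul1n.
  congr (_ *: 'X_[R, _]); apply/mnmP => l; rewrite mnmBE !mulmnE mnm1E.
  by case: eqP => _; rewrite ?mul1n ?subn1.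
by rewrite mpolyXn mderivX mulmnE mnm1E ij mul0n scale0r.
Qed.

Lemma power_sum_sublevel_bounded eta E p :
  0 < eta -> ~~ odd E -> deg_le E p ->
  bounded_set [set x : 'rV[R]_n | (eta *: power_sum E.+2 - p).@[x 0] <= 0].
Proof.
move=> eta_gt0 E_even /meval_growth[C C_ge0 pC].
exists (1 + C / eta); split; first exact: num_real.
move=> r r_gt x /=; rewrite mevalB mevalZ subr_le0 => x_sub.
rewrite leNgt; apply/negP => /(lt_trans r_gt) x_gt.
have Ce_ge0 : 0 <= C / eta by rewrite divr_ge0 // ltW.
have x_ge1 : 1 <= `|x| by apply: le_trans (ltW x_gt); rewrite lerDl.
have [j xj] : exists j, `|x 0 j| = `|x|.
  by apply: normr_coord_attained; rewrite -normr_gt0 (lt_le_trans ltr01).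
have : eta * `|x| ^+ E.+2 <= C * `|x| ^+ E.
  apply: le_trans (le_trans (ler_norm _) (pC x x_ge1)).
  apply: le_trans x_sub; rewrite ler_wpM2l ?(ltW eta_gt0) // meval_power_sum.
  have even_ge0 (y : R) : 0 <= y ^+ E.+2 by rewrite exprn_even_ge0 //= negbK.
  by rewrite (bigD1 j) //= -xj -normrX ger0_norm // lerDl sumr_ge0.
apply/negP; rewrite -ltNge -addn2 exprD mulrCA mulrC ltr_pM2l; last first.
  by rewrite exprn_gt0 // (lt_le_trans ltr01).
rewrite mulrC -ltr_pdivrMr //; apply: lt_le_trans (_ : `|x| <= _).
  by apply: le_lt_trans x_gt; rewrite lerDr.
by rewrite expr2 ler_peMr // (le_trans ler01).
Qed.

Section SignPatterns.
Variables (M : nat) (f : 'I_M -> {mpoly R[n]}).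

Definition sign_cell x0 : set 'rV[R]_n :=
  [set x | forall i, 0 < (f i).@[x 0] * (f i).@[x0 0]].

Definition weak_sign_cell x0 : set 'rV[R]_n :=
  [set x | forall i, 0 <= (f i).@[x 0] * (f i).@[x0 0]].

Lemma continuous_sign_product i x0 :
  continuous (fun x : 'rV[R]_n => (f i).@[x 0] * (f i).@[x0 0]).
Proof.
move=> x.
by apply: continuousM; [exact: meval_continuous|exact: cst_continuous].
Qed.

Lemma open_sign_cell x0 : open (sign_cell x0).
Proof.
rewrite openE => x x0x.
apply: (@filter_forall _ _
  (fun i (y : 'rV[R]_n) => 0 < (f i).@[y 0] * (f i).@[x0 0]) (nbhs x) _) => i.
exact: cvgr_gt (@continuous_sign_product i x0 x) _ (x0x i).
Qed.

Lemma closed_weak_sign_cell x0 : closed (weak_sign_cell x0).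
Proof.
have -> : weak_sign_cell x0 =
    \bigcap_i [set x | 0 <= (f i).@[x 0] * (f i).@[x0 0]].
  by apply/seteqP; split=> x /= xP i; [move=> _|]; exact: xP.
apply: closed_bigI => i _; apply: (preimage_closed _ (@closed_ge _ 0)) => x _.
exact: continuous_sign_product.
Qed.

Lemma sign_cell_critical_point p x0 :
  bounded_set [set x : 'rV[R]_n | p.@[x 0] <= 0] ->
  (forall x i, (f i).@[x 0] = 0 -> 0 <= p.@[x 0]) ->
  p.@[x0 0] < 0 ->
  exists2 x, sign_cell x0 x & forall j, (mderiv j p).@[x 0] = 0.
Proof.
move=> p_bounded p_wall p_x0.
pose A := weak_sign_cell x0 `&` [set x | p.@[x 0] <= 0].
have Ax0 : A x0 by split=> [i|] /=; [rewrite -expr2 sqr_ge0|exact: ltW].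
have A_compact : compact A.
  apply: bounded_closed_compact.
    by apply: sub_boundedr p_bounded => P bP x [_ /bP].
  apply: closedI; first exact: closed_weak_sign_cell.
  apply: (preimage_closed _ (@closed_le _ 0)) => x _; exact: meval_continuous.
have [x /set_mem[x_cell _] x_min] := EVT_min_rV (ex_intro _ _ Ax0)
  A_compact (continuous_subspaceT (@meval_continuous p)).
have p_x : p.@[x 0] < 0 by apply: le_lt_trans (x_min _ (mem_set Ax0)) p_x0.
have {}x_cell : sign_cell x0 x.
  move=> i; rewrite lt_neqAle x_cell eq_sym mulf_neq0 //.
    by apply: contraTneq p_x => /p_wall; rewrite -leNgt.
  by apply: contraTneq p_x0 => /p_wall; rewrite -leNgt.
exists x => // j; apply: mderiv_local_min.
have near_cell : \forall y \near x, sign_cell x0 y.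
  by apply: open_nbhs_nbhs; split; [exact: open_sign_cell|].
have near_neg : \forall y \near x, p.@[(y : 'rV[R]_n) 0] < 0.
  exact: cvgr_lt (@meval_continuous p x) _ p_x.
near=> y; apply: x_min; apply/mem_set; split=> [i|] /=; apply: ltW.
  by move: i; near: y.
by near: y.
Unshelve. all: by end_near.
Qed.

(* The function eta * power_sum - p is nonnegative on the walls of the sign
   cells and tends to infinity, so it has a critical point in each cell that
   contains a point where it is negative. *)
Lemma sign_cell_solution eta E p x0 :
  0 < eta -> ~~ odd E -> deg_le E p ->
  (forall x i, (f i).@[x 0] = 0 -> p.@[x 0] = 0) ->
  eta * (power_sum E.+2).@[x0 0] < p.@[x0 0] ->
  exists x, sign_cell x0 x /\ forall j,
    x 0 j ^+ E.+1 = ((eta * E.+2%:R)^-1 *: mderiv j p).@[x 0].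
Proof.
move=> eta_gt0 E_even pE p_wall p_x0.
have [|x i fx||x x_cell x_crit] :=
  @sign_cell_critical_point (eta *: power_sum E.+2 - p) x0.
- exact: power_sum_sublevel_bounded.
- rewrite mevalB mevalZ (p_wall x i fx) subr0.
  by rewrite mulr_ge0 ?(ltW eta_gt0) ?power_sum_ge0 //= negbK.
- by rewrite mevalB mevalZ subr_lt0.
exists x; split=> // j; have := x_crit j.
rewrite mderivB mderivZ mderiv_power_sum scalerA mevalB !mevalZ.
rewrite rmorphXn /= mevalXU => /subr0_eq <-.
by rewrite mulKf // mulf_neq0 ?gt_eqF.
Qed.

Lemma card_sign_patterns D (T : finType) (theta : T -> 'rV[R]_n) :
  (forall i, deg_le D (f i)) ->
  (forall t i, (f i).@[theta t 0] != 0) ->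
  (forall t t', t != t' ->
    exists i, (f i).@[theta t 0] * (f i).@[theta t' 0] < 0) ->
  (#|T| <= (2 * (M * D)).+1 ^ n)%N.
Proof.
move=> fD f_neq0 f_sep; set E := (2 * (M * D))%N.
have E_even : ~~ odd E by rewrite oddM.
pose F2 := (\prod_i f i) ^+ 2.
have F2E : deg_le E F2.
  by apply: deg_leXn; have := deg_le_prod fD; rewrite card_ord.
have F2_gt0 t : 0 < F2.@[theta t 0].
  rewrite rmorphXn /= exprn_even_gt0 //= rmorph_prod /=.
  by apply/prodf_neq0 => i _; exact: f_neq0.
have F2_wall x i : (f i).@[x 0] = 0 -> F2.@[x 0] = 0.
  by move=> fx; rewrite rmorphXn rmorph_prod /= (bigD1 i) //= fx mul0r expr0n.
have [eta eta_gt0 etaP] : exists2 eta : R, 0 < eta &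
    forall t, eta * (power_sum E.+2).@[theta t 0] < F2.@[theta t 0].
  by apply: exists_small_scale => // t; rewrite power_sum_ge0 //= negbK.
have /choice[z zP] t := sign_cell_solution eta_gt0 E_even F2E F2_wall (etaP t).
apply: (card_solutions (z := z) _ _ (fun t => (zP t).2)) => [t t' ztt'|j].
  apply/eqP; apply: contraT => /f_sep[l].
  have := mulr_gt0 ((zP t).1 l) ((zP t').1 l); rewrite ztt' mulrACA -expr2.
  by move=> /[swap] /ltW theta_le0; rewrite ltNge mulr_ge0_le0 ?sqr_ge0.
by apply/deg_leZ/deg_le_mderiv.
Qed.

End SignPatterns.

End PolynomialAnalysis.

Section MapMpoly.
Variables (S S' : comNzRingType) (n : nat) (h : {additive S -> S'}).

Lemma deg_le_map_mpoly D (p : {mpoly S[n]}) :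
  deg_le D p -> deg_le D (map_mpoly h p).
Proof.
move=> /deg_leP pD; apply/deg_leP => m.
rewrite mcoeff_msupp mcoeff_map_mpoly => hm.
by apply: pD; rewrite mcoeff_msupp; apply: contraNneq hm => ->; rewrite raddf0.
Qed.

Lemma map_mpoly_monomial c (m : multinom n) :
  map_mpoly h (c *: 'X_[S, m]) = h c *: 'X_[S', m].
Proof.
apply/mpolyP => m'; rewrite mcoeff_map_mpoly !mcoeffZ !mcoeffX.
by case: eqP => _; rewrite ?mulr1 // !mulr0 raddf0.
Qed.

Lemma meval_map_mpoly (iota : {rmorphism S' -> S}) (p : {mpoly S[n]})
    (x : 'I_n -> S') :
  (forall a b, h (a * iota b) = h a * b) ->
  (map_mpoly h p).@[x] = h p.@[iota \o x].
Proof.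
move=> h_linear; elim/mpolyind: p => [|c m p _ _ IHp].
  by rewrite raddf0 !meval0 raddf0.
rewrite raddfD !mevalD raddfD /= IHp map_mpoly_monomial !mevalZ !mevalX.
by rewrite -h_linear rmorph_prod; under [in RHS]eq_bigr do rewrite -rmorphXn.
Qed.

End MapMpoly.

Section SquaredNorm.
Variables (R : realType) (n : nat).
Implicit Types (p : {mpoly R[i][n]}).

Definition sqnorm_poly p : {mpoly R[n]} :=
  map_mpoly (@complex.Re R) p ^+ 2 + map_mpoly (@complex.Im R) p ^+ 2.

Lemma deg_le_sqnorm_poly D p : deg_le D p -> deg_le (2 * D) (sqnorm_poly p).
Proof. by move=> pD; apply: deg_leD; apply/deg_leXn/deg_le_map_mpoly. Qed.

Lemma meval_sqnorm_poly p (x : 'I_n -> R) :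
  (sqnorm_poly p).@[x] = normc p.@[real_complex R \o x] ^+ 2.
Proof.
rewrite mevalD !rmorphXn /=.
rewrite !(meval_map_mpoly (iota := real_complex R)); last 2 first.
- by move=> [a b] c /=; rewrite mulr0 add0r.
- by move=> [a b] c /=; rewrite mulr0 subr0.
by case: (_.@[_]) => a b /=; rewrite sqr_sqrtr // addr_ge0 // sqr_ge0.
Qed.

End SquaredNorm.

Section GenericMatrices.
Variables (R : realType) (k w : nat).

Definition coord_index : finType := (bool * ('I_k * ('I_w * 'I_w)))%type.

Definition real_coords (B : 'I_k -> 'M[R[i]]_w) : 'rV[R]_#|coord_index| :=
  \row_u let: (re, (r, (a, b))) := enum_val u in
    if re then complex.Re (B r a b) else complex.Im (B r a b).

Definition generic_mx (r : 'I_k) : 'M[{mpoly R[i][#|coord_index|]}]_w :=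
  \matrix_(a, b)
    ('X_[R[i], mnm1 (enum_rank ((true, (r, (a, b))) : coord_index))] +
     'i%C *: 'X_[R[i], mnm1 (enum_rank ((false, (r, (a, b))) : coord_index))]).

Lemma meval_generic_mx (B : 'I_k -> 'M[R[i]]_w) r :
  map_mx (meval (real_complex R \o real_coords B 0)) (generic_mx r) = B r.
Proof.
apply/matrixP => a b; rewrite !mxE mevalD mevalZ !mevalXU /= !mxE !enum_rankK.
by rewrite [RHS]complexE mulrC.
Qed.

Definition alternating_state (S : pzRingType) (A B : 'I_k -> 'M[S]_w)
    (v : 'cV[S]_w) : 'cV[S]_w :=
  foldl (fun v r => B r *m (A r *m v)) v (enum 'I_k).

Lemma map_alternating_state (S S' : pzRingType) (phi : {rmorphism S -> S'})
    (A B : 'I_k -> 'M[S]_w) v :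
  map_mx phi (alternating_state A B v) =
  alternating_state (fun r => map_mx phi (A r)) (fun r => map_mx phi (B r))
    (map_mx phi v).
Proof.
rewrite /alternating_state; elim: (enum _) v => //= r l IHl v.
by rewrite IHl !map_mxM.
Qed.

Lemma deg_le_alternating_state (S : comNzRingType) n
    (A B : 'I_k -> 'M[{mpoly S[n]}]_w) (v : 'cV_w) i :
  (forall r a b, deg_le 0 (A r a b)) -> (forall r a b, deg_le 1 (B r a b)) ->
  (forall a, deg_le 0 (v a 0)) -> deg_le k (alternating_state A B v i 0).
Proof.
move=> A0 B1 v0; rewrite /alternating_state -[X in deg_le X](size_enum_ord k).
elim/last_ind: (enum _) i => //= l r IHl i.
rewrite foldl_rcons size_rcons mxE; apply: deg_le_sum => a _.
rewrite -add1n; apply: deg_leM => //; rewrite mxE; apply: deg_le_sum => b _.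
by rewrite -[size l]add0n; apply: deg_leM.
Qed.

Lemma accept_polynomial (A : 'I_k -> 'M[R[i]]_w) (v : 'cV[R[i]]_w)
    (acc : {set 'I_w}) :
  exists2 p : {mpoly R[#|coord_index|]}, deg_le (2 * k) p &
    forall B, p.@[real_coords B 0] =
      \sum_(i in acc) normc (alternating_state A B v i 0) ^+ 2.
Proof.
pose cst_poly : R[i] -> {mpoly R[i][#|coord_index|]} := @mpolyC _ _.
pose psi := alternating_state (fun r => map_mx cst_poly (A r)) generic_mx
  (map_mx cst_poly v).
exists (\sum_(i in acc) sqnorm_poly (psi i 0)) => [|B].
  apply: deg_le_sum => i _; apply: deg_le_sqnorm_poly.
  apply: deg_le_alternating_state => [r a b|r a b|a]; rewrite mxE.
  - exact: deg_leC.
  - by apply: deg_leD; [|apply: deg_leZ]; exact: deg_leXU.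
  - exact: deg_leC.
rewrite raddf_sum; apply: eq_bigr => i _; rewrite /= meval_sqnorm_poly.
pose ev := meval (real_complex R \o real_coords B 0).
have evC m1 m2 (X : 'M[R[i]]_(m1, m2)) : map_mx ev (map_mx cst_poly X) = X.
  by apply/matrixP => a b; rewrite !mxE; exact: mevalC.
have -> : alternating_state A B v = map_mx ev psi.
  rewrite map_alternating_state evC.
  congr (alternating_state _ _ v); apply/funext => r; first by rewrite evC.
  by rewrite meval_generic_mx.
by rewrite mxE.
Qed.

End GenericMatrices.

Section Subfunctions.
Variables (R : realType) (k n w : nat) (P : kQOBDD R k n w).
Implicit Types (sigma tau : {ffun 'I_n -> bool}) (l : seq 'I_(k * n)).

Definition segment_mx sigma l : 'M[R[i]]_w :=
  foldl (fun A s => qgate P s (sigma (qorder P (read_pos s))) *m A) 1%:M l.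

Lemma foldl_qstep sigma psi l :
  foldl (qstep P sigma) psi l = segment_mx sigma l *m psi.
Proof.
elim/last_ind: l => [|l s IHl]; first by rewrite mul1mx.
by rewrite /segment_mx !foldl_rcons IHl -mulmxA.
Qed.

Lemma eq_segment_mx sigma tau l :
  (forall s, s \in l ->
    sigma (qorder P (read_pos s)) = tau (qorder P (read_pos s))) ->
  segment_mx sigma l = segment_mx tau l.
Proof.
rewrite /segment_mx; elim: l 1%:M => //= s l IHl A eq_l.
by rewrite eq_l ?mem_head // IHl // => u ul; rewrite eq_l // in_cons ul orbT.
Qed.

Definition steps (a b : nat) : seq 'I_(k * n) := pmap insub (iota a b).

Lemma stepsD a b c : steps a (b + c) = steps a b ++ steps (a + b) c.
Proof. by rewrite /steps iotaD pmap_cat. Qed.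

Lemma steps_rounds K :
  steps 0 (K * n) = flatten [seq steps (r * n) n | r <- iota 0 K].
Proof.
elim: K => // K IHK.
rewrite -addn1 iotaD map_cat flatten_cat -IHK /= cats0 addn1.
by rewrite mulSn addnC stepsD.
Qed.

Lemma enum_steps :
  enum 'I_(k * n) = flatten [seq steps (r * n) n | r : 'I_k <- enum 'I_k].
Proof.
rewrite (map_comp (fun r => steps (r * n) n) val) val_enum_ord -steps_rounds.
by rewrite enumT unlock.
Qed.

Lemma read_pos_steps r a b s :
  (a + b <= n)%N -> s \in steps (r * n + a) b -> (a <= read_pos s < a + b)%N.
Proof.
move=> abn; rewrite mem_pmap_sub mem_iota /= => /andP[rs sr].
have -> : (s %% n = s - r * n)%N.
  rewrite -[in LHS](subnKC (leq_trans (leq_addr a _) rs)) modnMDl modn_small //.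
  by lia.
by lia.
Qed.

Definition splice (pi : 'S_n) (c : nat) sigma tau : {ffun 'I_n -> bool} :=
  [ffun i => if (pi^-1%g i < c)%N then sigma i else tau i].

Lemma qfinal_splice c sigma tau : (c <= n)%N ->
  qfinal P (splice (qorder P) c sigma tau) =
  alternating_state
    (fun r : 'I_k => segment_mx sigma (steps (r * n) c))
    (fun r : 'I_k => segment_mx tau (steps (r * n + c) (n - c)))
    (delta_mx (qinit P) 0).
Proof.
move=> cn; rewrite /qfinal enum_steps /alternating_state.
elim/last_ind: (enum 'I_k) => //= l r IHl.
have round_split :
    steps (r * n) n = steps (r * n) c ++ steps (r * n + c) (n - c).
  by rewrite -stepsD subnKC.
have prefixE : segment_mx (splice (qorder P) c sigma tau) (steps (r * n) c) =
    segment_mx sigma (steps (r * n) c).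
  apply: eq_segment_mx => s; rewrite -[(r * n)%N]addn0.
  by move=> /(@read_pos_steps _ 0 _ _ cn)/andP[_ sc]; rewrite ffunE permK sc.
have suffixE :
    segment_mx (splice (qorder P) c sigma tau) (steps (r * n + c) (n - c)) =
    segment_mx tau (steps (r * n + c) (n - c)).
  have c_suffix : (c + (n - c) <= n)%N by rewrite subnKC.
  apply: eq_segment_mx => s /(read_pos_steps c_suffix)/andP[cs _].
  by rewrite ffunE permK ltnNge cs.
rewrite map_rcons flatten_rcons foldl_rcons foldl_cat IHl round_split foldl_cat.
by rewrite !foldl_qstep prefixE suffixE.
Qed.

Lemma accept_prob_gap f sigma : computes_bounded_error P f ->
  if f sigma then 0 < accept_prob P sigma - 1 / 2
  else accept_prob P sigma - 1 / 2 < 0.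
Proof.
move=> [eps eps_gt0 /(_ sigma)[f1 f0]].
by case: (f sigma) f1 f0 => [/(_ erefl) acc _|_ /(_ erefl) acc]; lra.
Qed.

Lemma card_subfunctions (f : boolfun n) c M (T : finType)
    (sigma : 'I_M -> {ffun 'I_n -> bool}) (tau : T -> {ffun 'I_n -> bool}) :
  (c <= n)%N -> computes_bounded_error P f ->
  (forall t t', t != t' -> exists y,
    f (splice (qorder P) c (sigma y) (tau t)) !=
    f (splice (qorder P) c (sigma y) (tau t'))) ->
  (#|T| <= (2 * (M * (2 * k))).+1 ^ (2 * (k * (w * w))))%N.
Proof.
move=> cn fP f_sep.
pose B t (r : 'I_k) := segment_mx (tau t) (steps (r * n + c) (n - c)).
have /choice[p pP] y : exists p : {mpoly R[#|coord_index k w|]},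
    deg_le (2 * k) p /\ forall t, p.@[real_coords (B t) 0] =
      accept_prob P (splice (qorder P) c (sigma y) (tau t)) - 1 / 2.
  have [p pD pE] := accept_polynomial
    (fun r : 'I_k => segment_mx (sigma y) (steps (r * n) c))
    (delta_mx (qinit P) 0) (qaccept P).
  exists (p - mpolyC _ (1 / 2)); split; first by rewrite deg_leB ?deg_leC.
  by move=> t; rewrite mevalB mevalC pE /accept_prob qfinal_splice.
have -> : (2 * (k * (w * w)))%N = #|coord_index k w|.
  by rewrite !card_prod card_bool !card_ord.
apply: (@card_sign_patterns R _ M p (2 * k) T (fun t => real_coords (B t))).
- by move=> y; have [] := pP y.
- move=> t y; rewrite (pP y).2.
  have := accept_prob_gap (splice (qorder P) c (sigma y) (tau t)) fP.
  by case: (f _) => [/gt_eqF|/lt_eqF] ->.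
- move=> t t' /f_sep[y f_neq]; exists y; rewrite !(pP y).2; move: f_neq.
  have := accept_prob_gap (splice (qorder P) c (sigma y) (tau t)) fP.
  have := accept_prob_gap (splice (qorder P) c (sigma y) (tau t')) fP.
  case: (f (splice _ _ _ (tau t))); case: (f _) => //= gap' gap _.
    by rewrite pmulr_rlt0.
  by rewrite nmulr_rlt0.
Qed.

End Subfunctions.

Section PermutationMatrices.
Variables (C : numClosedFieldType) (w : nat).
Implicit Types (s : 'S_w).

Lemma perm_mx_unitary s : perm_mx s \is @unitarymx C w w.
Proof.
by apply/unitarymxP; rewrite tr_perm_mx map_perm_mx -perm_mxM mulgV perm_mx1.
Qed.

Lemma perm_mx_delta s i :
  perm_mx s *m delta_mx i 0 = delta_mx (s^-1%g i) 0 :> 'cV[C]_w.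
Proof.
by rewrite -colE; apply/colP => j; rewrite !mxE andbT (canF_eq (permK s)).
Qed.

End PermutationMatrices.

Lemma accept_prob_basis (R : realType) (k n w : nat) (P : kQOBDD R k n w)
    (sigma : {ffun 'I_n -> bool}) i :
  qfinal P sigma = delta_mx i 0 ->
  accept_prob P sigma = (i \in qaccept P)%:R.
Proof.
move=> finalE; rewrite /accept_prob finalE.
have normc_bool (b : bool) : normc (b%:R : R[i]) ^+ 2 = b%:R.
  case: b; first by rewrite ComplexField.Normc.normc1 expr1n.
  by rewrite ComplexField.Normc.normc0 expr0n.
under eq_bigr do rewrite mxE andbT normc_bool.
rewrite big_mkcond (bigD1 i) //= eqxx big1 => [|j /negPf ->].
  by rewrite addr0; case: ifP.
by rewrite if_same.
Qed.

Lemma read_pos_first_round (k n : nat) : (0 < k)%N ->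
  [seq read_pos s | s : 'I_(k * n) <- enum 'I_(k * n) & (s < n)%N] = enum 'I_n.
Proof.
move=> k_gt0; apply: (inj_map val_inj); rewrite -map_comp.
have /eq_in_map -> : {in [seq s : 'I_(k * n) <- enum 'I_(k * n) | (s < n)%N],
    val \o @read_pos k n =1 val}.
  by move=> s; rewrite mem_filter => /andP[sn _]; rewrite /= modn_small.
rewrite -(filter_map val (fun s => s < n)%N) !val_enum_ord.
by rewrite (@filter_iota_ltn 0) ?leq_pmull.
Qed.

Section ReversiblePrograms.
Variables (R : realType) (k n : nat) (T : finType) (u0 : T) (acc : pred T).
Variables (f : boolfun n) (W : R).
Hypothesis card_le : #|T|%:R <= W.

Lemma reversible_QOBDD (step : 'I_(k * n) -> bool -> T -> T) :
  (forall s b, injective (step s b)) ->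
  (forall sigma, f sigma =
    acc (foldl (fun u s => step s (sigma (read_pos s)) u) u0
      (enum 'I_(k * n)))) ->
  id_QOBDD k W f.
Proof.
move=> step_inj fE.
pose g s b (i : 'I_#|T|) := enum_rank (step s b (enum_val i)).
have g_inj s b : injective (g s b).
  by move=> i j /enum_rank_inj /step_inj /enum_val_inj.
pose P := KQOBDD 1%g (enum_rank u0) [set i | acc (enum_val i)]
  (fun s b => perm_mx_unitary R[i] (perm (@g_inj s b))^-1).
exists #|T|, P; split=> //; exists (1 / 2) => [|sigma].
  by rewrite divr_gt0.
have finalE : qfinal P sigma = delta_mx (enum_rank
    (foldl (fun u s => step s (sigma (read_pos s)) u) u0 (enum 'I_(k * n)))) 0.
  rewrite /qfinal; elim/last_ind: (enum _) => // l s IHl.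
  rewrite !foldl_rcons IHl /qstep /= perm1 perm_mx_delta invgK permE.
  by rewrite /g enum_rankK.
rewrite (accept_prob_basis finalE) inE enum_rankK -fE.
by split=> -> /=; lra.
Qed.

Lemma one_pass_reversible_QOBDD (step : 'I_n -> bool -> T -> T) :
  (0 < k)%N -> (forall i b, injective (step i b)) ->
  (forall sigma,
    f sigma = acc (foldl (fun u i => step i (sigma i) u) u0 (enum 'I_n))) ->
  id_QOBDD k W f.
Proof.
move=> k_gt0 step_inj fE.
pose step' (s : 'I_(k * n)) b := if (s < n)%N then step (read_pos s) b else id.
apply: (reversible_QOBDD (step := step')) => [s b|sigma].
  by rewrite /step'; case: ifP => _; [exact: step_inj|exact: inj_id].
rewrite fE -(read_pos_first_round n k_gt0); congr acc.
elim: (enum _) u0 => //= s l IHl u.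
by rewrite /step'; case: ifP => sn /=; rewrite IHl.
Qed.

End ReversiblePrograms.

Lemma id_QOBDD_true (R : realType) (k n : nat) (W : R) : 1 <= W ->
  id_QOBDD k W ((fun=> true) : boolfun n).
Proof.
move=> W_ge1.
apply: (@reversible_QOBDD R k n unit tt xpredT _ W _ (fun _ _ => id)) => //.
  by rewrite card_unit.
by move=> s b; exact: inj_id.
Qed.

Definition bit (n : nat) (sigma : {ffun 'I_n -> bool}) (i : nat) : bool :=
  if insub i is Some j then sigma j else false.

Lemma bit_ord n (sigma : {ffun 'I_n -> bool}) (i : 'I_n) :
  bit sigma i = sigma i.
Proof. by rewrite /bit valK. Qed.

Lemma bit_finfun n (g : nat -> bool) i :
  bit [ffun j : 'I_n => g j] i = (i < n)%N && g i.
Proof.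
by rewrite /bit; case: insubP => [j -> <-|/negPf ->]; rewrite ?ffunE.
Qed.

Lemma bit_splice n c (sigma tau : {ffun 'I_n -> bool}) i :
  bit (splice 1 c sigma tau) i = if (i < c)%N then bit sigma i else bit tau i.
Proof.
rewrite /bit; case: insubP => [j _ <-|_]; last by rewrite if_same.
by rewrite ffunE invg1 perm1.
Qed.

Lemma foldl_iotaS (S : Type) (g : S -> nat -> S) u a t :
  foldl g u (iota a t.+1) = g (foldl g u (iota a t)) (a + t)%N.
Proof. by rewrite -addn1 iotaD foldl_cat. Qed.

Section AddressFunction.
Variables (n q : nat).
Let m := q.+1.
Implicit Types (sigma : {ffun 'I_n -> bool}).

(* A sum modulo m, rather than a binary address, makes reading each bit of the
   address a reversible step. *)
Definition address sigma : 'I_m := \sum_(i < m | bit sigma i) i.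

Definition addressed_bit sigma : bool := bit sigma (m + address sigma).

Definition address_step (i : nat) (b : bool) (u : 'I_m * bool) : 'I_m * bool :=
  if ~~ b then u
  else if (i < m)%N then (u.1 + inZp i, u.2)
  else (u.1, u.2 (+) (m + u.1 == i)%N).

Lemma address_step_inj i b : injective (address_step i b).
Proof.
rewrite /address_step => -[a c] [a' c']; case: b => //=.
case: ifP => _ /eqP; rewrite xpair_eqE ?(inj_eq (addIr _)) => /andP[/eqP ->].
  by move=> /eqP ->.
by move=> /eqP /addIb ->.
Qed.

Lemma foldl_address_step_low sigma t : (t <= m)%N ->
  foldl (fun u i => address_step i (bit sigma i) u) (0, false) (iota 0 t) =
  (\sum_(0 <= i < t | bit sigma i) inZp i, false).
Proof.
elim: t => [|t IHt] tm; first by rewrite big_geq.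
rewrite foldl_iotaS IHt 1?ltnW // /address_step add0n tm.
rewrite [in RHS]big_mkcond big_nat_recr //= -big_mkcond /=.
by case: (bit sigma t); rewrite ?addr0.
Qed.

Lemma foldl_address_step_high sigma (a : 'I_m) t :
  foldl (fun u i => address_step i (bit sigma i) u) (a, false) (iota m t) =
  (a, (a < t)%N && bit sigma (m + a)).
Proof.
elim: t => // t IHt.
rewrite foldl_iotaS IHt /address_step [(m + t < m)%N]ltnNge leq_addr /=.
rewrite eqn_add2l ltnS; have [->|a_neq_t] := eqVneq (val a) t.
  by rewrite ltnn leqnn; case: (bit _ _).
by rewrite addbF if_same [(a < t)%N]ltn_neqAle a_neq_t.
Qed.

Lemma foldl_address_step sigma : (m <= n)%N ->
  foldl (fun u (i : 'I_n) => address_step i (sigma i) u) (0, false)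
    (enum 'I_n) =
  (address sigma, addressed_bit sigma).
Proof.
move=> mn; pose step u i := address_step i (bit sigma i) u.
have -> : foldl (fun u (i : 'I_n) => address_step i (sigma i) u) (0, false)
    (enum 'I_n) = foldl step (0, false) (iota 0 n).
  rewrite -val_enum_ord; elim: (enum _) (_, _) => //= i l IHl u.
  by rewrite -IHl /step bit_ord.
rewrite -(subnKC mn) iotaD foldl_cat.
rewrite foldl_address_step_low // foldl_address_step_high.
have -> : \sum_(0 <= i < m | bit sigma i) inZp i = address sigma.
  by rewrite big_mkord; apply: eq_bigr => i _; rewrite valZpK.
congr (_, _); rewrite /addressed_bit /bit.
by case: insubP => [j jn _|_]; rewrite ?andbF // ltn_subRL jn.
Qed.

Definition address_bits (j : 'I_m) : {ffun 'I_n -> bool} :=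
  [ffun i : 'I_n => i == j :> nat].

Definition data_bits (x : {ffun 'I_m -> bool}) : {ffun 'I_n -> bool} :=
  [ffun i : 'I_n => bit x (i - m)].

Lemma address_splice (j : 'I_m) (tau : {ffun 'I_n -> bool}) : (m <= n)%N ->
  address (splice 1 m (address_bits j) tau) = j.
Proof.
move=> mn; rewrite /address (eq_bigl (pred1 j)) ?big_pred1_eq // => i.
rewrite bit_splice ltn_ord (bit_finfun n (fun i => i == j)).
by rewrite (leq_trans (ltn_ord i) mn).
Qed.

Lemma addressed_bit_splice (j : 'I_m) (x : {ffun 'I_m -> bool}) :
  (m + m <= n)%N ->
  addressed_bit (splice 1 m (address_bits j) (data_bits x)) = x j.
Proof.
move=> mn; have mj : (m + j < n)%N by rewrite (leq_trans _ mn) // ltn_add2l.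
rewrite /addressed_bit address_splice ?(leq_trans (leq_addr m m)) // bit_splice.
rewrite ltnNge leq_addr /= (bit_finfun n (fun i => bit x (i - m))) mj addKn.
exact: bit_ord.
Qed.

Lemma id_QOBDD_addressed_bit (R : realType) k (W : R) :
  (0 < k)%N -> (m <= n)%N -> (2 * m)%:R <= W ->
  id_QOBDD k W (@addressed_bit : boolfun n).
Proof.
move=> k_gt0 mn mW.
apply: (@one_pass_reversible_QOBDD R k n ('I_m * bool)%type (0, false) snd _ W _
  (fun i => address_step i)) => // [|i b|sigma].
- by rewrite card_prod card_ord card_bool mulnC.
- exact: address_step_inj.
- by rewrite foldl_address_step.
Qed.

Lemma addressed_bit_width (R : realType) k (W : R) : (m + m <= n)%N ->
  id_QOBDD k W (@addressed_bit : boolfun n) ->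
  exists2 w : nat, w%:R <= W &
    (2 ^ m <= (2 * (m * (2 * k))).+1 ^ (2 * (k * (w * w))))%N.
Proof.
move=> mn [w [P [wW order1 fP]]]; exists w => //.
have := @card_subfunctions _ _ _ _ P _ m m _ address_bits data_bits
  (leq_trans (leq_addr m m) mn) fP.
rewrite card_ffun card_bool card_ord; apply=> x x' x_neq.
have /existsP[j xj] : [exists j, x j != x' j].
  apply: contraNT x_neq => /existsPn xE.
  by apply/eqP/ffunP => j; exact/eqP/negPn.
by exists j; rewrite order1 !addressed_bit_splice.
Qed.

End AddressFunction.

Lemma subset_id_QOBDD (R : realType) (k n : nat) (W W' : R) :
  W <= W' -> id_QOBDD k (n := n) W `<=` id_QOBDD k W'.
Proof.
move=> WW' f [w [P [wW order1 fP]]]; exists w, P; split=> //.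
exact: le_trans wW WW'.
Qed.

Lemma id_QOBDD_width_ge1 (R : realType) (k n : nat) (W : R) (f : boolfun n) :
  id_QOBDD k W f -> 1 <= W.
Proof.
move=> [w [P [wW _ _]]]; apply: le_trans wW.
by rewrite ler1n (leq_ltn_trans _ (ltn_ord (qinit P))).
Qed.

Lemma ler_nat_sqrt_div (R : realType) (w d c : nat) : (0 < c)%N ->
  (w%:R <= Num.sqrt (d%:R / c%:R) :> R) = (c * w ^ 2 <= d)%N.
Proof.
move=> c_gt0; rewrite -{1}[w%:R]ger0_norm // -sqrtr_sqr.
rewrite ler_psqrt ?nnegrE ?divr_ge0 ?exprn_ge0 // ler_pdivlMr ?ltr0n //.
by rewrite -natrX -natrM ler_nat mulnC.
Qed.

Lemma trunc_log_le_log2 (R : realType) d : (0 < d)%N ->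
  (trunc_log 2 d)%:R <= log2 d%:R :> R.
Proof.
move=> d_gt0; rewrite /log2 ler_pdivlMr ?ln_gt0 ?ltr1n // mulr_natl -lnXn //.
by rewrite ler_ln ?posrE ?exprn_gt0 ?ltr0n // -natrX ler_nat trunc_logP.
Qed.

Lemma double_trunc_log_leq d : (0 < d)%N -> (2 * trunc_log 2 d <= d)%N.
Proof.
move=> d_gt0; apply: leq_trans (@trunc_logP 2 d isT d_gt0).
by case: (trunc_log 2 d) => // t; rewrite expnS leq_pmul2l // ltn_expl.
Qed.

Lemma subfunction_bound_lt k d w : (0 < k)%N -> (16 * k <= d)%N ->
  (16 * (k * (w * w)) <= d)%N ->
  ((2 * (d * trunc_log 2 d * (2 * k))).+1 ^ (2 * (k * (w * w))) <
   2 ^ (d * trunc_log 2 d))%N.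
Proof.
move=> k_gt0 kd; move: (k * (w * w))%N => v vd.
have d_gt0 : (0 < d)%N by lia.
have t_gt0 : (0 < trunc_log 2 d)%N by rewrite trunc_log_gt0; lia.
have := (@trunc_logP 2 d isT d_gt0, @trunc_log_ltn 2 d isT).
move: (trunc_log 2 d) t_gt0 => t t_gt0 [td dt].
have t_le_d : (t <= d)%N by apply: leq_trans td; apply: ltnW; exact: ltn_expl.
have base_le : ((2 * (d * t * (2 * k))).+1 <= 2 ^ (6 * t))%N.
  apply: (@leq_trans (d * d * d)).
    have : (d * t * (16 * k) <= d * d * d)%N by rewrite leq_mul // leq_mul.
    have : (d <= d * d * d)%N by rewrite -mulnA leq_pmulr // muln_gt0 d_gt0.
    by lia.
  apply: (@leq_trans ((2 ^ t.+1) ^ 3)).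
    by rewrite !expnS expn0 muln1 mulnA !leq_mul // ltnW // -expnS.
  by rewrite -expnM leq_exp2l //; lia.
apply: (@leq_ltn_trans ((2 ^ (6 * t)) ^ (2 * v))).
  by case: (posnP v) => [->|v_gt0] //; rewrite leq_exp2r ?muln_gt0.
rewrite -expnM ltn_exp2l //.
have : (16 * v * t <= d * t)%N by rewrite leq_mul.
have : (0 < d * t)%N by rewrite muln_gt0 d_gt0.
by nia.
Qed.

Lemma id_QOBDD_proper (R : realType) (k d n : nat) : (0 < k)%N -> (0 < d)%N ->
  (2 * (d * trunc_log 2 d) <= n)%N ->
  id_QOBDD k (n := n) (Num.sqrt (d%:R / (16 * k%:R)) : R) `<`
  id_QOBDD k (d%:R ^+ 2 : R).
Proof.
move=> k_gt0 d_gt0 n_large; rewrite -natrM.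
have c_gt0 : (0 < 16 * k)%N by rewrite muln_gt0.
have d2_ge1 : 1 <= d%:R ^+ 2 :> R by rewrite exprn_ege1 // ler1n.
split.
  apply: subset_id_QOBDD; rewrite -[leRHS]ger0_norm ?sqr_ge0 // -sqrtr_sqr.
  apply: ler_wsqrtr; rewrite ler_pdivrMr ?ltr0n //.
  rewrite -!natrX -natrM ler_nat -expnM.
  by rewrite (leq_trans (leq_pexp2l d_gt0 (isT : (1 <= 4)%N))) // leq_pmulr.
have [d_small|d_large] := ltnP d (16 * k).
  move=> /(_ _ (id_QOBDD_true k n d2_ge1))/id_QOBDD_width_ge1.
  by rewrite (ler_nat_sqrt_div R 1) // exp1n muln1 leqNgt d_small.
have : (0 < d * trunc_log 2 d)%N by rewrite muln_gt0 d_gt0 trunc_log_gt0; lia.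
case mE : (d * trunc_log 2 d)%N n_large => [//|q] n_large _.
have m_le_d2 : (2 * q.+1)%:R <= d%:R ^+ 2 :> R.
  by rewrite -natrX ler_nat -mE mulnCA -mulnn leq_mul // double_trunc_log_leq.
move: n_large; rewrite mul2n -addnn => n_large.
have q_le_n : (q.+1 <= n)%N by apply: leq_trans n_large; exact: leq_addr.
move=> /(_ _ (id_QOBDD_addressed_bit k_gt0 q_le_n m_le_d2)).
move=> /(addressed_bit_width n_large)[w].
rewrite ler_nat_sqrt_div // -mulnA -mulnn => w_small.
by rewrite leqNgt -mE subfunction_bound_lt.
Qed.

Theorem theorem4 (R : realType) :
  exists2 C1 : R, 0 < C1 &
    forall k d : nat -> nat,
      (forall n, (0 < k n)%N) ->
      (forall n, (0 < d n)%N) ->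
      (fun n : nat => (k n)%:R * (d n)%:R * log2 (d n)%:R : R^o)
        =o_\oo (fun n : nat => n%:R : R^o) ->
      \forall n \near \oo,
        id_QOBDD (k n) (n := n) (Num.sqrt ((d n)%:R / (C1 * (k n)%:R))) `<`
        id_QOBDD (k n) (n := n) ((d n)%:R ^+ 2 : R).
Proof.
exists 16 => // k d k_gt0 d_gt0 /eqoP small; near=> n.
apply: id_QOBDD_proper => //.
have kd_log_le :
    `|(k n)%:R * (d n)%:R * log2 (d n)%:R| <= 1 / 2 * `|n%:R : R^o| :> R.
  by near: n; apply: small; rewrite divr_gt0.
have d_trunc_log_le : (d n)%:R * (trunc_log 2 (d n))%:R <=
    (k n)%:R * (d n)%:R * log2 (d n)%:R :> R.
  by rewrite ler_pM ?trunc_log_le_log2 // ler_peMl // ler1n.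
rewrite -(ler_nat R) !natrM.
have := le_trans d_trunc_log_le (le_trans (ler_norm _) kd_log_le).
by rewrite [`|n%:R|]normr_nat; lra.
Unshelve. all: by end_near.
Qed.
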